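(* For every positive integer $n$, we have $n \le N_{3n}(\frac{1}{2}) \le n+1$.
   Context: For a positive integer $m$, let $\mathcal{P}_m$ denote the family of all sets of $m$ points in the Euclidean plane such that the distance between any two points of the set is at most $1$. For $0 < r \le 1$, let $N_m(r)$ be the largest integer $k$ such that for every $P \in \mathcal{P}_m$ there exists a circle of radius $r$ (i.e. a closed disc of radius $r$) which covers (contains) at least $k$ points of $P$. *)

(* Defs.v *)
From mathcomp Require Import all_boot all_order all_algebra.
From mathcomp Require Import boolp reals.
Set Implicit Arguments. Unset Strict Implicit. Unset Printing Implicit Defensive.
Import Order.TTheory GRing.Theory Num.Theory.
Local Open Scope ring_scope.

Definition dist2 {R : rcfType} (p q : R * R) : R :=
  Num.sqrt ((p.1 - q.1) ^+ 2 + (p.2 - q.2) ^+ 2).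

Definition in_Pm {R : rcfType} (m : nat) (P : 'I_m -> R * R) : Prop :=
  injective P /\ forall i j, dist2 (P i) (P j) <= 1.

Definition covered {R : rcfType} (m : nat) (P : 'I_m -> R * R) (c : R * R) (r : R) : nat :=
  #|[set i | dist2 (P i) c <= r]|.

Definition admissible {R : rcfType} (m : nat) (r : R) (k : nat) : Prop :=
  forall P : 'I_m -> R * R, in_Pm P -> exists c : R * R, (k <= covered P c r)%N.

(* N_m(r): the largest admissible k (admissible k forces k <= m since P_m is
   nonempty, and k = 0 is always admissible). *)
Definition N {R : rcfType} (m : nat) (r : R) : nat :=
  \max_(k < m.+1 | `[< admissible m r k >]) k.

(* Main.v *)
Require Import Defs.
From mathcomp Require Import all_boot all_order all_algebra.
From mathcomp Require Import boolp reals.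
From mathcomp Require Import ring lra zify.
Import Order.TTheory GRing.Theory Num.Theory.
Local Open Scope ring_scope.

(* Lower bound.  By Jung's theorem (obtained from the case of three points through
   Radon points, as in Helly's theorem) the points lie in a disc of radius
   1/sqrt 3, which three discs of radius 1/2 cover; one of these contains a third
   of the points.

   Upper bound.  Keep [n] points very close to each vertex of an equilateral
   triangle of side 1, all distances at most 1, so that a disc of radius 1/2
   contains at most [n + 1] of them.  Add at each vertex a satellite at distance
   about [e], where [e] is far larger than the size of the old clusters, lying
   just outside the disc whose diameter is the side to the next vertex, but at
   distance less than 1 from the other two vertices.  A disc of radius 1/2 meets at
   most two clusters.  If it meets both old clusters, it nearly is the disc having
   that side as a diameter, so it misses one of the two satellites and contains at
   most [(n + 1) + 1] points.  Otherwise it contains at most [n] old points and two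
   satellites. *)

(** * Squared distances *)

Definition sqdist {R : rcfType} (p q : R * R) : R :=
  (p.1 - q.1) ^+ 2 + (p.2 - q.2) ^+ 2.

Lemma sqdistC {R : rcfType} (p q : R * R) : sqdist p q = sqdist q p.
Proof. by rewrite /sqdist; ring. Qed.

Lemma sqdist_ge0 {R : rcfType} (p q : R * R) : 0 <= sqdist p q.
Proof. by rewrite addr_ge0 ?sqr_ge0. Qed.

Lemma dist2_le {R : rcfType} (p q : R * R) (r : R) :
  0 <= r -> (dist2 p q <= r) = (sqdist p q <= r ^+ 2).
Proof.
by move=> r0; rewrite -{1}(ger0_norm r0) -sqrtr_sqr ler_sqrt ?sqr_ge0.
Qed.

(** * Jung's theorem in the plane *)

Lemma affine_dependence {R : rcfType} (x : 'I_4 -> R * R) :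
  exists l : 'I_4 -> R, [/\ exists i, l i != 0, \sum_i l i = 0,
    \sum_i l i * (x i).1 = 0 & \sum_i l i * (x i).2 = 0].
Proof.
pose M : 'M[R]_(4, 3) := \matrix_(i, j)
  (if (j == 0 :> nat)%N then 1 else if (j == 1 :> nat)%N then (x i).1 else (x i).2).
have : kermx M != 0.
  by rewrite -mxrank_eq0 mxrank_ker -lt0n subn_gt0 (leq_ltn_trans (rank_leq_col M)).
case/rowV0Pn => v /sub_kermxP vM /rV0Pn[i vi].
have E j : \sum_k v 0 k * M k j = 0 by have /matrixP/(_ 0 j) := vM; rewrite !mxE.
exists (fun k => v 0 k); split; first by exists i.
- by rewrite -[RHS](E 0); apply: eq_bigr => k _; rewrite mxE mulr1.
- by rewrite -[RHS](E 1); apply: eq_bigr => k _; rewrite mxE.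
- by rewrite -[RHS](E (inord 2)); apply: eq_bigr => k _; rewrite mxE inordK.
Qed.

(** The weighted mean of the squared distances to [p] is [sqdist z p] plus the weighted mean of
    those to [z]. *)
Lemma convex_sqdist {R : rcfType} {I : finType} (w : I -> R) (x : I -> R * R)
    (p z : R * R) (r : R) :
  (forall i, 0 <= w i) -> \sum_i w i = 1 ->
  z.1 = \sum_i w i * (x i).1 -> z.2 = \sum_i w i * (x i).2 ->
  (forall i, 0 < w i -> sqdist (x i) p <= r) -> sqdist z p <= r.
Proof.
move=> w0 w1 z1 z2 H.
have E : \sum_i w i * sqdist (x i) p = sqdist z p + \sum_i w i * sqdist (x i) z.
  apply/eqP; rewrite -subr_eq -sumrB; apply/eqP.
  transitivity (\sum_i (w i * (x i).1 * (2 * (z.1 - p.1)) +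
     w i * (x i).2 * (2 * (z.2 - p.2)) +
     w i * (p.1 ^+ 2 + p.2 ^+ 2 - z.1 ^+ 2 - z.2 ^+ 2))).
    by apply: eq_bigr => i _; rewrite /sqdist; ring.
  by rewrite !big_split /= -!mulr_suml -z1 -z2 w1 /sqdist; ring.
have : \sum_i w i * sqdist (x i) p <= \sum_i w i * r.
  apply: ler_sum => i _; have := w0 i; rewrite le_eqVlt => /orP[/eqP<-|wi].
    by rewrite !mul0r.
  by rewrite ler_wpM2l ?H // ltW.
rewrite -mulr_suml w1 mul1r E; apply: le_trans.
by rewrite lerDl sumr_ge0 // => i _; rewrite mulr_ge0 ?sqdist_ge0.
Qed.

(* Radon: the common point of the hulls of the positive and of the negative part
   of an affine dependence. *)
Lemma radon_point {R : rcfType} (x : 'I_4 -> R * R) :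
  exists z, forall p r j, (forall i, i != j -> sqdist (x i) p <= r) ->
    sqdist z p <= r.
Proof.
have [l [[k lk] l0 l1 l2]] := affine_dependence x.
pose lp i := Num.max (l i) 0; pose ln i := Num.max (- l i) 0.
have lE i : l i = lp i - ln i.
  by rewrite /lp /ln; case: (lerP (l i) 0); case: (lerP (- l i) 0); lra.
have lp0 i : 0 <= lp i by rewrite le_max lexx orbT.
have ln0 i : 0 <= ln i by rewrite le_max lexx orbT.
have sumE (f : 'I_4 -> R) : \sum_i l i * f i = 0 ->
    \sum_i lp i * f i = \sum_i ln i * f i.
  move=> h; apply/eqP; rewrite -subr_eq0 -sumrB -[X in _ == X]h; apply/eqP.
  by apply: eq_bigr => i _; rewrite lE mulrBl.
pose S := \sum_i lp i.
have SE : \sum_i ln i = S.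
  by apply/eqP; rewrite eq_sym -subr_eq0 -sumrB -[X in _ == X]l0; apply/eqP/eq_bigr.
have S0 : 0 < S.
  rewrite lt0r sumr_ge0 ?andbT //; apply/eqP => S00.
  have lpk : lp k = 0.
    apply/eqP; move/eqP: S00; rewrite psumr_eq0 // => /allP/(_ k); apply.
    by rewrite mem_index_enum.
  have lnk : ln k = 0.
    apply/eqP; move/eqP: S00; rewrite -SE psumr_eq0 // => /allP/(_ k); apply.
    by rewrite mem_index_enum.
  by move: lk; rewrite lE lpk lnk subrr eqxx.
exists ((\sum_i lp i * (x i).1) / S, (\sum_i lp i * (x i).2) / S) => p r j H.
(* Of the two representations of the point, take the one giving [x j] weight zero. *)
have [lj|lj] := lerP (l j) 0.
  apply: (convex_sqdist (fun i => lp i / S) x) => /=.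
  - by move=> i; rewrite divr_ge0 // ltW.
  - by rewrite -mulr_suml divff // gt_eqF.
  - by rewrite mulr_suml; apply: eq_bigr => i _; rewrite mulrAC.
  - by rewrite mulr_suml; apply: eq_bigr => i _; rewrite mulrAC.
  move=> i; rewrite pmulr_lgt0 ?invr_gt0 // => li; apply: H.
  by apply: contraTneq li => ->; rewrite /lp (max_idPr _) ?ltxx.
apply: (convex_sqdist (fun i => ln i / S) x) => /=.
- by move=> i; rewrite divr_ge0 // ltW.
- by rewrite -mulr_suml SE divff // gt_eqF.
- by rewrite sumE // mulr_suml; apply: eq_bigr => i _; rewrite mulrAC.
- by rewrite sumE // mulr_suml; apply: eq_bigr => i _; rewrite mulrAC.
move=> i; rewrite pmulr_lgt0 ?invr_gt0 // => li; apply: H.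
by apply: contraTneq li => ->; rewrite /ln (max_idPr _) ?ltxx // oppr_le0 ltW.
Qed.

(** The angle at [c] is not acute, so [c] lies in the disc with diameter [a b], of squared radius at
    most 1/4. *)
Lemma midpoint_jung {R : rcfType} (a b c : R * R) :
  sqdist a b <= 1 ->
  (a.1 - c.1) * (b.1 - c.1) + (a.2 - c.2) * (b.2 - c.2) <= 0 ->
  exists z, [/\ sqdist a z <= 3^-1, sqdist b z <= 3^-1 & sqdist c z <= 3^-1].
Proof.
move=> ab h; exists ((a.1 + b.1) / 2, (a.2 + b.2) / 2).
have Ea : sqdist a ((a.1 + b.1) / 2, (a.2 + b.2) / 2) = sqdist a b / 4.
  by rewrite /sqdist /=; field.
have Eb : sqdist b ((a.1 + b.1) / 2, (a.2 + b.2) / 2) = sqdist a b / 4.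
  by rewrite /sqdist /=; field.
have Ec : sqdist c ((a.1 + b.1) / 2, (a.2 + b.2) / 2) = sqdist a b / 4 +
   ((a.1 - c.1) * (b.1 - c.1) + (a.2 - c.2) * (b.2 - c.2)).
  by rewrite /sqdist /=; field.
by split; rewrite ?Ea ?Eb ?Ec; lra.
Qed.

(* In terms of squared side lengths, [4 A B - (A + B - C) ^+ 2] is sixteen times
   the squared area, so that this bounds the squared circumradius by 1/3. *)
Lemma acute_area {R : rcfType} (A B C : R) :
  A <= 1 -> B <= 1 -> C <= 1 -> A <= B + C -> B <= A + C -> C <= A + B ->
  3 * (A * B * C) <= 4 * (A * B) - (A + B - C) ^+ 2.
Proof.
(* With [Z] largest, [X + Y - Z] is at most both [X] and [Y]. The right side is symmetric in the
   three sides. *)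
have W (X Y Z : R) : Z <= 1 -> X <= Z -> Y <= Z -> Z <= X + Y ->
    3 * (X * Y * Z) <= 4 * (X * Y) - (X + Y - Z) ^+ 2.
  move=> Z1 XZ YZ ZXY.
  have X0 : 0 <= X by lra.
  have Y0 : 0 <= Y by lra.
  have h1 : 0 <= X * Y * (1 - Z) by rewrite !mulr_ge0 ?subr_ge0.
  have h2 : (X + Y - Z) ^+ 2 <= X * Y by rewrite expr2 ler_pM //; lra.
  nra.
move=> A1 B1 C1 hA hB hC.
have [AC|CA] := lerP A C; have [BC|CB] := lerP B C.
- exact: W.
- by have := W A C B B1 ltac:(lra) ltac:(lra) hB; lra.
- by have := W B C A A1 ltac:(lra) ltac:(lra) hA; lra.
have [AB|BA] := lerP A B.
- by have := W A C B B1 AB ltac:(lra) hB; lra.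
- by have := W B C A A1 ltac:(lra) ltac:(lra) hA; lra.
Qed.

Lemma jung3 {R : rcfType} (a b c : R * R) :
  sqdist a b <= 1 -> sqdist b c <= 1 -> sqdist c a <= 1 ->
  exists z, [/\ sqdist a z <= 3^-1, sqdist b z <= 3^-1 & sqdist c z <= 3^-1].
Proof.
move=> ab bc ca.
have [h|hc] := lerP ((a.1 - c.1) * (b.1 - c.1) + (a.2 - c.2) * (b.2 - c.2)) 0.
  exact: midpoint_jung.
have [h|ha] := lerP ((b.1 - a.1) * (c.1 - a.1) + (b.2 - a.2) * (c.2 - a.2)) 0.
  by have [z []] := midpoint_jung _ _ _ bc h; exists z.
have [h|hb] := lerP ((c.1 - b.1) * (a.1 - b.1) + (c.2 - b.2) * (a.2 - b.2)) 0.
  by have [z []] := midpoint_jung _ _ _ ca h; exists z.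
pose u1 := b.1 - a.1; pose u2 := b.2 - a.2.
pose v1 := c.1 - a.1; pose v2 := c.2 - a.2.
pose d := u1 * v2 - u2 * v1.
pose A := u1 ^+ 2 + u2 ^+ 2; pose B := v1 ^+ 2 + v2 ^+ 2.
have AE : sqdist a b = A by rewrite /sqdist /A /u1 /u2; ring.
have BE : sqdist c a = B by rewrite /sqdist /B /v1 /v2; ring.
have hG : 4 * d ^+ 2 = 4 * (A * B) - (A + B - sqdist b c) ^+ 2.
  by rewrite /d /A /B /sqdist /u1 /u2 /v1 /v2; ring.
have area : 3 * (A * B * sqdist b c) <= 4 * d ^+ 2.
  rewrite hG; apply: acute_area; rewrite -?AE -?BE // /sqdist; nra.
(* Acute angles force positive sides, so [area] itself excludes a degenerate triangle. *)
have d0 : 0 < d ^+ 2.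
  have : 0 < A * B * sqdist b c.
    by rewrite !mulr_gt0 // -?AE -?BE /sqdist; nra.
  nra.
have dN : d != 0 by apply: contraTneq d0 => ->; rewrite expr0n ltxx.
(* The circumcentre, by Cramer's rule; [R2] bounds the squared circumradius. *)
exists (a.1 + (v2 * A - u2 * B) / (2 * d), a.2 + (u1 * B - v1 * A) / (2 * d)).
have R2 : A * B * sqdist b c / (4 * d ^+ 2) <= 3^-1.
  move: area d0; move: (A * B * _) (d ^+ 2) => X Y XY Y0.
  by rewrite ler_pdivrMr; lra.
by split; apply: le_trans R2; rewrite le_eqVlt; apply/orP; left; apply/eqP;
  rewrite /sqdist /A /B; move: dN; rewrite /d /u1 /u2 /v1 /v2 /= => dN; field.
Qed.

(** Induction on the size: omit each of four points in turn and take the Radon point of the four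
    centres obtained. *)
Lemma jung {R : rcfType} (s : seq (R * R)) :
  {in s &, forall p q, sqdist p q <= 1} ->
  exists z, {in s, forall p, sqdist p z <= 3^-1}.
Proof.
have [m] := ubnP (size s); elim: m s => // m IH [|a [|b [|c [|d t]]]] sm H.
- by exists (0, 0).
- by exists a => p; rewrite inE => /eqP->; rewrite /sqdist; lra.
- have [|||z [za zb _]] := jung3 a b b; try by apply: H; rewrite !inE eqxx ?orbT.
  by exists z => p; rewrite !inE => /orP[]/eqP->.
- have [|||z [za zb zc]] := jung3 a b c; try by apply: H; rewrite !inE eqxx ?orbT.
  by exists z => p; rewrite !inE => /or3P[]/eqP->.
have sub (l : seq (R * R)) : (size l < m)%N -> {subset l <= [:: a, b, c, d & t]} ->
    exists z, {in l, forall p, sqdist p z <= 3^-1}.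
  by move=> lm ls; apply: IH => // p q /ls ? /ls ?; exact: H.
have [|x0 X0] := sub [:: b, c, d & t] sm.
  by move=> p; rewrite !inE => ->; rewrite orbT.
have [|x1 X1] := sub [:: a, c, d & t] sm.
  by move=> p; rewrite !inE; case: (p == a) (p == b) (p == c) (p == d) => [] [] [] [] /=.
have [|x2 X2] := sub [:: a, b, d & t] sm.
  by move=> p; rewrite !inE; case: (p == a) (p == b) (p == c) (p == d) => [] [] [] [] /=.
have [|x3 X3] := sub [:: a, b, c & t] sm.
  by move=> p; rewrite !inE; case: (p == a) (p == b) (p == c) (p == d) => [] [] [] [] /=.
have [z Hz] := radon_point (fun i : 'I_4 => nth x0 [:: x0; x1; x2; x3] i).
exists z => p ps; rewrite sqdistC.
(* [j] indexes the only list that may omit [p]; for [p] in [t] any index would do. *)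
have [j Hj] : exists j : 'I_4, forall i : 'I_4, i != j ->
    p \in nth [::] [:: [:: b, c, d & t]; [:: a, c, d & t];
                       [:: a, b, d & t]; [:: a, b, c & t]] i.
  move: ps; rewrite !inE => /or4P[/eqP->|/eqP->|/eqP->|/orP[/eqP->|pt]].
  - by exists 0 => -[[|[|[|[|]]]] ?] //; rewrite !inE eqxx ?orbT.
  - by exists 1 => -[[|[|[|[|]]]] ?] //; rewrite !inE eqxx ?orbT.
  - by exists (inord 2) => -[[|[|[|[|]]]] ?]; rewrite -?val_eqE /= ?inordK //;
      rewrite !inE eqxx ?orbT.
  - by exists (inord 3) => -[[|[|[|[|]]]] ?]; rewrite -?val_eqE /= ?inordK //;
      rewrite !inE eqxx ?orbT.
  - by exists 0 => -[[|[|[|[|]]]] ?] //; rewrite !inE pt ?orbT.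
apply: (Hz _ _ j) => i /Hj; rewrite sqdistC.
by case: i => -[|[|[|[|]]]] ? //=; [apply: X0|apply: X1|apply: X2|apply: X3].
Qed.

(* The disc of radius 1/sqrt 3 about [z] is covered by the discs of radius 1/2
   about three points at distance 1/(2 sqrt 3) from [z] in directions
   120 degrees apart. *)
Lemma three_discs {R : rcfType} (z : R * R) :
  exists c : 'I_3 -> R * R, forall p, sqdist p z <= 3^-1 ->
    exists k, sqdist p (c k) <= 4^-1.
Proof.
pose h : R := Num.sqrt 3; have h2 : h ^+ 2 = 3 by rewrite sqr_sqrtr.
have h0 : 0 < h by rewrite sqrtr_gt0.
exists (fun k => nth z [:: (z.1 + h / 6, z.2); (z.1 - h / 12, z.2 + 4^-1);
                          (z.1 - h / 12, z.2 - 4^-1)] k) => p.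
rewrite /sqdist; move: (p.1 - z.1) (p.2 - z.2) (subrK z.1 p.1) (subrK z.2 p.2).
move=> x y <- <- H.
(* Coordinates along and across the axis of a 120-degree sector; the squared distance to the centre
   at [h / 6] is the left side plus 1/12. *)
have key (a b : R) : b <= h * a -> - b <= h * a -> a ^+ 2 + b ^+ 2 <= 3^-1 ->
   a ^+ 2 + b ^+ 2 - h * a / 3 <= 6^-1.
  move=> ba ba' ab.
  have a0 : 0 <= h * a by lra.
  have bb : 0 <= (h * a - b) * (h * a + b) by rewrite mulr_ge0; lra.
  have r2 : a ^+ 2 = (h * a) ^+ 2 / 3 by rewrite exprMn h2; lra.
  move: (h * a) a0 bb r2 => r a0 bb r2.
  (* Near the apex the sides of the sector give the bound, further out the circle does. *)
  have [?|?] := lerP (2 * r) 1; last lra.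
  have : 0 <= (1 - 2 * r) * (4 * r + 1) by rewrite mulr_ge0; lra.
  nra.
(* The sign [e] selects a rotation by 120 degrees either way, reducing the other two sectors to
   [key]. *)
have rot (e : R) : e ^+ 2 = 1 -> 0 <= e * y -> h * x <= e * y ->
    x ^+ 2 + y ^+ 2 - (- x + e * (h * y)) / 2 * h / 3 <= 6^-1.
  move=> e2 ey hx.
  have E : ((- x + e * (h * y)) / 2) ^+ 2 + ((- (h * x) - e * y) / 2) ^+ 2 =
      x ^+ 2 + y ^+ 2.
    transitivity (((1 + h ^+ 2) * x ^+ 2 + e ^+ 2 * (1 + h ^+ 2) * y ^+ 2) / 4).
      by field.
    by rewrite h2 e2; field.
  have hE : h * ((- x + e * (h * y)) / 2) = (- (h * x) + 3 * (e * y)) / 2.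
    by rewrite -h2; field.
  by rewrite -E (mulrC _ h); apply: key; rewrite ?E ?hE //; lra.
have [y0|y0] := lerP 0 y.
  have [c1|c1] := lerP y (h * x).
    exists 0 => /=; have := key x y c1 ltac:(lra) H; nra.
  by exists 1 => /=; have := rot 1 ltac:(lra) ltac:(lra) ltac:(lra); nra.
have [c1|c1] := lerP (- y) (h * x).
  exists 0 => /=; have := key x y ltac:(lra) c1 H; nra.
by exists (inord 2); rewrite inordK //=;
  have := rot (-1) ltac:(lra) ltac:(lra) ltac:(lra); nra.
Qed.

(** * The equilateral triangle and its satellites *)

Lemma ord3_ind (Q : 'I_3 -> Prop) : Q 0 -> Q 1 -> Q (1 + 1) -> forall i, Q i.
Proof.
move=> Q0 Q1 Q2 [[|[|[|//]]] H].
- by rewrite (_ : Ordinal H = 0) //; apply: val_inj.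
- by rewrite (_ : Ordinal H = 1) //; apply: val_inj.
- by rewrite (_ : Ordinal H = 1 + 1) //; apply: val_inj.
Qed.

Lemma sum_ord3 (f : 'I_3 -> nat) : (\sum_k f k = f 0%R + f 1%R + f (1 + 1)%R)%N.
Proof.
rewrite !big_ord_recl big_ord0 addn0 addnA.
by congr (addn (addn (f _) (f _)) (f _)); apply: val_inj.
Qed.

Definition vertex {R : rcfType} (k : 'I_3) : R * R :=
  let h := Num.sqrt 3 in
  nth 0 [:: (- 2^-1, - h / 6); (2^-1, - h / 6); (0, h / 3)] k.

(* The displacement is [e] along the inner normal of the side from [vertex k] to
   [vertex (k + 1)] plus [3/4 e^2] along that side; near [vertex k] this parabola
   runs between the circle about [vertex (k + 1)] and the circle having the side
   as a diameter. *)
Definition satellite {R : rcfType} (e : R) (k : 'I_3) : R * R :=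
  let h := Num.sqrt 3 in let f := 3 / 4 * e ^+ 2 in
  ((vertex k).1 + nth 0 [:: f; - f / 2 - h * e / 2; - f / 2 + h * e / 2] k,
  (vertex k).2 + nth 0 [:: e; h * f / 2 - e / 2; - h * f / 2 - e / 2] k).

Definition vertex_mid {R : rcfType} (k : 'I_3) : R * R :=
  (((vertex k).1 + (vertex (k + 1)).1) / 2, ((vertex k).2 + (vertex (k + 1)).2) / 2).

Lemma sqrt3_powers {R : rcfType} (e : R) (h := Num.sqrt 3 : R) :
  1 <= h /\ forall n, h * h * e ^+ n = 3 * e ^+ n.
Proof.
have h2 : h * h = 3 by rewrite -expr2 sqr_sqrtr.
have h0 : 0 <= h by rewrite sqrtr_ge0.
by split=> [|n]; [nra | rewrite h2].
Qed.

Lemma sqdist_vertex {R : rcfType} (k l : 'I_3) :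
  k != l -> sqdist (vertex k) (vertex l) = 1 :> R.
Proof.
elim/ord3_ind: k; elim/ord3_ind: l => //= _; rewrite /sqdist /vertex /=;
  have := sqrt3_powers (0 : R); move: (Num.sqrt 3) => h [h1 P];
  move: (P 0%N) (P 1%N) (P 2%N) (P 3%N) (P 4%N); lra.
Qed.

(** The centroid is the origin, so the sum is [1 + 3 |c|^2]. *)
Lemma sqdist_vertex_sum {R : rcfType} (c : R * R) :
  1 <= sqdist (vertex 0) c + sqdist (vertex 1) c + sqdist (vertex (1 + 1)) c.
Proof.
rewrite /sqdist /vertex /=;
  have := sqrt3_powers (0 : R); move: (Num.sqrt 3) => h [h1 P];
  move: (P 0%N) (P 1%N) (P 2%N) (P 3%N) (P 4%N); nra.
Qed.

Lemma satellite_vertex {R : rcfType} (e : R) k :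
  sqdist (satellite e k) (vertex k) = e ^+ 2 + 9 / 16 * e ^+ 4.
Proof.
elim/ord3_ind: k; rewrite /sqdist /satellite /vertex /=;
  have := sqrt3_powers e; move: (Num.sqrt 3) => h [h1 P];
  move: (P 0%N) (P 1%N) (P 2%N) (P 3%N) (P 4%N); lra.
Qed.

(** The normal displacement adds [e^2], the one along the side removes only [3/4 e^2] up to a
    nonnegative term in [e^4]. *)
Lemma satellite_mid {R : rcfType} (e : R) k :
  4^-1 + e ^+ 2 / 4 <= sqdist (satellite e k) (vertex_mid k).
Proof.
have : 0 <= e ^+ 4 by rewrite exprn_even_ge0.
elim/ord3_ind: k; rewrite /sqdist /satellite /vertex_mid /vertex /=;
  have := sqrt3_powers e; move: (Num.sqrt 3) => h [h1 P];
  move: (P 0%N) (P 1%N) (P 2%N) (P 3%N) (P 4%N); lra.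
Qed.

(** The squared distance to the next vertex is [1 - e^2 / 2] up to order [e^4]; to the remaining
    vertex it falls by [h e] to first order. *)
Lemma satellite_far_vertex {R : rcfType} (e : R) k l :
  0 < e -> e <= 1 / 200 -> k != l ->
  sqdist (satellite e k) (vertex l) <= 1 - e ^+ 2 / 4.
Proof.
move=> e0 e1.
have f1 : e ^+ 2 <= e / 200 by rewrite expr2; nra.
have f2 : 0 <= e ^+ 2 by rewrite sqr_ge0.
have f3 : e ^+ 4 <= e ^+ 2 / 200.
  by have -> : e ^+ 4 = e ^+ 2 * e ^+ 2; [rewrite -exprD | rewrite ler_wpM2l //; lra].
elim/ord3_ind: k; elim/ord3_ind: l => //= _;
  rewrite /sqdist /satellite /vertex /=;
  have := sqrt3_powers e; move: (Num.sqrt 3) => h [h1 P];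
  have : e <= h * e by [rewrite ler_peMl // ltW];
  move: (P 0%N) (P 1%N) (P 2%N) (P 3%N) (P 4%N); lra.
Qed.

Lemma satellite_far {R : rcfType} (e : R) k l :
  0 < e -> e <= 1 / 200 -> k != l ->
  sqdist (satellite e k) (satellite e l) <= 1.
Proof.
move=> e0 e1.
have f1 : e ^+ 2 <= e / 200 by rewrite expr2; nra.
have f2 : 0 <= e ^+ 2 by rewrite sqr_ge0.
have f3 : e ^+ 4 <= e ^+ 2 / 200.
  by have -> : e ^+ 4 = e ^+ 2 * e ^+ 2; [rewrite -exprD | rewrite ler_wpM2l //; lra].
elim/ord3_ind: k; elim/ord3_ind: l => //= _;
  rewrite /sqdist /satellite /vertex /=;
  have := sqrt3_powers e; move: (Num.sqrt 3) => h [h1 P];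
  have : e <= h * e by [rewrite ler_peMl // ltW];
  move: (P 0%N) (P 1%N) (P 2%N) (P 3%N) (P 4%N); lra.
Qed.

(** * Perturbation estimates in the sup norm *)

Definition near {R : rcfType} (e : R) (p q : R * R) :=
  `|p.1 - q.1| <= e /\ `|p.2 - q.2| <= e.

Lemma nearC {R : rcfType} (e : R) p q : near e p q -> near e q p.
Proof. by rewrite /near (distrC q.1) (distrC q.2). Qed.

Lemma near_trans {R : rcfType} (e f : R) p q r :
  near e p q -> near f q r -> near (e + f) p r.
Proof.
move=> [h1 h2] [h3 h4].
by split; [apply: le_trans (ler_distD q.1 _ _) (lerD h1 h3)
          |apply: le_trans (ler_distD q.2 _ _) (lerD h2 h4)].
Qed.

Lemma near_le {R : rcfType} (e f : R) p q : e <= f -> near e p q -> near f p q.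
Proof. by move=> ef [h1 h2]; split; apply: le_trans ef. Qed.

Lemma near_of_sqdist {R : rcfType} (e : R) p q :
  0 <= e -> sqdist p q <= e ^+ 2 -> near e p q.
Proof.
move=> e0 h; split; rewrite -(ger0_norm e0) -ler_sqr ?qualifE /= ?normr_ge0 //;
  rewrite !real_normK ?num_real //; apply: le_trans h.
- by rewrite lerDl sqr_ge0.
- by rewrite lerDr sqr_ge0.
Qed.

Lemma sqdist_of_near {R : rcfType} (e : R) p q :
  near e p q -> sqdist p q <= 2 * e ^+ 2.
Proof.
move=> [h1 h2]; have e0 : 0 <= e := le_trans (normr_ge0 _) h1.
have W x : `|x| <= e -> x ^+ 2 <= e ^+ 2.
  by move=> h; rewrite -real_normK ?num_real // ler_sqr ?qualifE /=.
by rewrite mulr_natl mulr2n lerD ?W.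
Qed.

(** Each coordinate contributes at most [2 e + e^2], hence at most [3 e]. *)
Lemma near_sqdist {R : rcfType} (e : R) p p' q :
  near e p p' -> e <= 1 -> sqdist p q <= 1 -> sqdist p' q <= sqdist p q + 6 * e.
Proof.
move=> pp e1 pq; have e0 : 0 <= e := le_trans (normr_ge0 _) pp.1.
have [n1 n2] : near 1 p q by apply: near_of_sqdist; rewrite ?expr1n.
have W x x' y : `|x - x'| <= e -> `|x - y| <= 1 ->
    (x' - y) ^+ 2 <= (x - y) ^+ 2 + 3 * e.
  rewrite !ler_norml => /andP[a b] /andP[c d].
  have -> : (x' - y) ^+ 2 = (x - y) ^+ 2 - 2 * ((x - x') * (x - y)) + (x - x') ^+ 2.
    by ring.
  have : (x - x') ^+ 2 <= e by nra.
  have : - e <= (x - x') * (x - y) by nra.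
  lra.
have := W _ _ _ pp.1 n1; have := W _ _ _ pp.2 n2; rewrite /sqdist; lra.
Qed.

(** Otherwise the squared distances from [c] to the vertices would sum to at most
    [3/4 + 18 e < 1]. *)
Lemma half_disc_misses_vertex {R : rcfType} (e : R) (c : R * R)
    (p : 'I_3 -> R * R) :
  e <= 1 / 100 -> (forall k, near e (p k) (vertex k)) ->
  ~ forall k, sqdist (p k) c <= 4^-1.
Proof.
move=> e1 pn pc.
have W k : sqdist (vertex k) c <= 4^-1 + 6 * e.
  have := near_sqdist _ _ _ c (pn k); have := pc k; lra.
have := sqdist_vertex_sum c; have := W 0; have := W 1; have := W (1 + 1); lra.
Qed.

Lemma ord3_succ_neq (k : 'I_3) : k != k + 1.
Proof. by elim/ord3_ind: k. Qed.

(* A disc of radius 1/2 that meets the inner clusters near the ends of a side is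
   almost the disc having this side as a diameter, so it leaves out the satellite. *)
Lemma satellite_excluded {R : rcfType} (e : R) (k : 'I_3) (c p q : R * R) :
  0 < e -> e <= 1 / 200 ->
  near ((e ^+ 2 / 100) ^+ 2) p (vertex k) ->
  near ((e ^+ 2 / 100) ^+ 2) q (vertex (k + 1)) ->
  sqdist p c <= 4^-1 -> sqdist q c <= 4^-1 ->
  sqdist (satellite e k) c <= 4^-1 -> False.
Proof.
move=> e0 e1 pn qn pc qc ac.
have f0 : 0 < e ^+ 2 by rewrite exprn_gt0.
have f1 : e ^+ 2 <= 1 / 200 by rewrite expr2; nra.
have := satellite_mid e k; move: (e ^+ 2) f0 f1 pn qn => f f0 f1 pn qn am.
have g1 : (f / 100) ^+ 2 <= 1 by rewrite expr_le1 //; lra.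
have := near_sqdist _ _ _ c pn g1; have := near_sqdist _ _ _ c qn g1.
have par : sqdist c (vertex_mid k) = (sqdist (vertex k) c + sqdist (vertex (k + 1)) c) / 2
    - sqdist (vertex k) (vertex (k + 1)) / 4.
  by rewrite /sqdist /vertex_mid /=; field.
move=> h1 h2.
(* With [g = (f / 100)^2], the median formula [par] bounds the squared offset of [c] by [6 g], below
   [16 g = (f / 25)^2]. The resulting error [6 f / 25] is less than the excess [f / 4] of the
   satellite. *)
have cm : near (f / 25) c (vertex_mid k).
  apply: near_of_sqdist; first lra.
  rewrite par sqdist_vertex ?ord3_succ_neq //.
  have -> : (f / 25) ^+ 2 = 16 * (f / 100) ^+ 2 by field.
  have : 0 <= (f / 100) ^+ 2 by rewrite sqr_ge0.
  have /h1 : sqdist q c <= 1 by lra.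
  have /h2 : sqdist p c <= 1 by lra.
  move: (_ ^+ 2) => g; lra.
have := near_sqdist _ _ _ (satellite e k) cm.
rewrite (sqdistC c) (sqdistC (vertex_mid k)); lra.
Qed.

(** * Inductive construction of the clusters *)

(** Distances inside one cluster are left to [near], which bounds them when [e] is small. *)
Definition clustered {R : rcfType} (e : R) (n : nat) (S : 'I_3 -> seq (R * R)) :=
  [/\ forall k, size (S k) = n /\ uniq (S k),
      forall k, {in S k, forall p, near e p (vertex k)},
      forall k l, k != l -> {in S k & S l, forall p q, sqdist p q <= 1} &
      forall c, (\sum_k count (fun p => sqdist p c <= 4^-1)%R (S k) <= n.+1)%N].

(** Inner clusters of size of order [e^4] fix the centre of a critical disc up to order [e^2], the
    order by which a satellite lies outside. *)
Lemma clustered_extend {R : rcfType} (e : R) n S :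
  0 < e -> e <= 1 / 200 -> clustered ((e ^+ 2 / 100) ^+ 2) n S ->
  clustered (2 * e) n.+1 (fun k => satellite e k :: S k).
Proof.
move=> e0 e1 [Ssz Snear Sdist Scount].
have f0 : 0 < e ^+ 2 by rewrite exprn_gt0.
have f1 : e ^+ 2 <= e / 200 by rewrite expr2; nra.
have d0 : 0 < (e ^+ 2 / 100) ^+ 2 by rewrite exprn_gt0 //; lra.
have d1 : (e ^+ 2 / 100) ^+ 2 <= e ^+ 2 / 100 by rewrite expr2; nra.
have e4 : e ^+ 4 = e ^+ 2 * e ^+ 2 by rewrite -exprD.
have d2 : 2 * ((e ^+ 2 / 100) ^+ 2) ^+ 2 < e ^+ 2.
  by move: ((e ^+ 2 / 100) ^+ 2) d0 d1 => d ? ?; rewrite expr2; nra.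
have satnear k : near (2 * e) (satellite e k) (vertex k).
  apply: near_of_sqdist; first lra.
  by rewrite satellite_vertex e4 exprMn; nra.
have cross k l p : k != l -> p \in S l -> sqdist (satellite e k) p <= 1.
  move=> kl pS; have sv := satellite_far_vertex _ _ _ e0 e1 kl.
  have := near_sqdist _ _ _ (satellite e k) (nearC _ _ _ (Snear l p pS)).
  rewrite (sqdistC p) (sqdistC (vertex l)); lra.
split.
- move=> k; have [sz un] := Ssz k; split=> /=; first by rewrite sz.
  (* The satellite is new, being further from its vertex than the inner cluster reaches. *)
  rewrite un andbT; apply/negP => /Snear /sqdist_of_near.
  by rewrite satellite_vertex e4; nra.
- move=> k p; rewrite inE => /orP[/eqP->|/Snear] //.
  by apply: near_le; lra.
- move=> k l kl p q; rewrite !inE => /orP[/eqP->|pS] /orP[/eqP->|qS].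
  + exact: satellite_far.
  + exact: cross qS.
  + by rewrite sqdistC (cross l k) // eq_sym.
  + exact: (Sdist k l).
move=> c.
set D := fun p : R * R => sqdist p c <= 4^-1.
have hasD (T : seq (R * R)) : (0 < count D T)%N ->
    exists2 p, p \in T & sqdist p c <= 4^-1.
  by rewrite -has_count => /hasP.
have miss : ~ forall k, (0 < count D (satellite e k :: S k))%N.
  move=> h; pose Q k p := p \in satellite e k :: S k /\ sqdist p c <= 4^-1.
  have /choice[p Qp] : forall k, exists p, Q k p.
    by move=> k; have [p ? ?] := hasD _ (h k); exists p.
  apply: (half_disc_misses_vertex (2 * e) c p); first lra.
    move=> k; have [] := Qp k; rewrite inE => /orP[/eqP->|/Snear pn _] //.
    apply: near_le pn; lra.
  by move=> k; case: (Qp k).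
have excl k : (0 < count D (S k))%N -> (0 < count D (S (k + 1)%R))%N ->
    ~~ D (satellite e k).
  move=> /hasD[p pS pc] /hasD[q qS qc]; apply/negP => ac.
  exact: (satellite_excluded e k c p q e0 e1 (Snear _ _ pS) (Snear _ _ qS)).
have bound k : (count D (S k) <= n)%N by rewrite -(Ssz k).1 count_size.
have := Scount c; rewrite -/D !sum_ord3 /=.
(* Any two of the three indices are cyclically consecutive, so the three instances of [excl] treat
   every pair of old clusters. *)
have := excl (1 + 1); rewrite (_ : 1 + 1 + 1 = 0 :> 'I_3); last exact: val_inj.
have := excl 1; have := excl 0; rewrite add0r.
have : ~ ((0 < D (satellite e 0%R) + count D (S 0%R))%N /\
  (0 < D (satellite e 1%R) + count D (S 1%R))%N /\
  (0 < D (satellite e (1 + 1)%R) + count D (S (1 + 1)%R))%N).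
  by move=> [h0 [h1 h2]]; apply: miss; apply: ord3_ind.
have := bound 0; have := bound 1; have := bound (1 + 1).
move: (D _) (D _) (D _) (count _ _) (count _ _) (count _ _).
move=> [] [] [] x0 x1 x2 /=; lia.
Qed.

(** The induction keeps [e] general, since each layer of satellites needs far smaller clusters
    inside it. *)
Lemma clustered_exists {R : rcfType} (n : nat) (e : R) :
  0 < e -> e <= 1 / 100 -> exists S, clustered e n S.
Proof.
elim: n e => [|n IH] e e0 e1.
  exists (fun=> [::]); split=> // c.
  by rewrite big1.
have f0 : 0 < (e / 2) ^+ 2 by rewrite exprn_gt0 //; lra.
have f1 : (e / 2) ^+ 2 <= 1 / 100 by rewrite expr2; nra.
have [||S HS] := IH (((e / 2) ^+ 2 / 100) ^+ 2).
- by rewrite exprn_gt0 //; lra.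
- by rewrite expr2; nra.
exists (fun k => satellite (e / 2) k :: S k).
by rewrite -[e in clustered e](divfK (_ : 2 != 0)) ?pnatr_eq0 // mulrC;
  apply: clustered_extend => //; lra.
Qed.

(** * Counting and the two bounds *)

Lemma card_count_nth {T : eqType} (x0 : T) (s : seq T) (D : pred T) m :
  size s = m -> #|[set i : 'I_m | D (nth x0 s i)]| = count D s.
Proof.
move=> <-; rewrite cardsE -sum1_card -sum1_count (big_nth x0) big_mkord.
exact: eq_bigl.
Qed.

Lemma half_sq {R : rcfType} : 2^-1 ^+ 2 = 4^-1 :> R.
Proof. by field. Qed.

Lemma N_le {R : rcfType} (n : nat) : (N (3 * n) (2^-1 : R) <= n.+1)%N.
Proof.
have [||S [Ssz Snear Sdist Scount]] := @clustered_exists R n (1 / 100); try lra.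
pose s := S 0 ++ S 1 ++ S (1 + 1).
have disj k l : k != l -> ~~ has (mem (S k)) (S l).
  move=> kl; apply/negP => /hasP[p /Snear pl /Snear pk].
  have h := sqdist_of_near _ _ _ pk.
  have := near_sqdist _ _ _ (vertex k) pl.
  by rewrite (sqdist_vertex l k) 1?eq_sym //; lra.
have us : uniq s.
  by rewrite !cat_uniq !(Ssz _).2 has_cat negb_or !disj.
have sz : size s = (3 * n)%N by rewrite !size_cat !(Ssz _).1; lia.
have sdist : {in s &, forall p q, sqdist p q <= 1}.
  have all_in p : p \in s -> exists k, p \in S k.
    by rewrite !mem_cat => /or3P[]; eexists; eassumption.
  move=> p q /all_in[k pk] /all_in[l ql].
  have [E|/Sdist->//] := eqVneq k l.
  rewrite -E in ql.
  have := near_trans _ _ _ _ _ (Snear _ _ pk) (nearC _ _ _ (Snear _ _ ql)).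
  by move/sqdist_of_near; lra.
apply/bigmax_leqP => k /asboolP /(_ (fun i => nth 0 s i)) [|c].
  split=> [i j /eqP|i j].
    by rewrite nth_uniq ?sz // => /eqP/val_inj.
  by rewrite dist2_le // expr1n sdist ?mem_nth ?sz.
move=> /leq_trans; apply; apply: leq_trans (Scount c).
have -> : covered (fun i : 'I_(3 * n) => nth 0 s i) c 2^-1 =
    count (fun p => dist2 p c <= 2^-1) s := card_count_nth 0 s _ _ sz.
rewrite (eq_count (a2 := fun p => sqdist p c <= 4^-1)) => [|p]; last first.
  by rewrite dist2_le ?invr_ge0 // half_sq.
by rewrite !count_cat sum_ord3 addnA.
Qed.

(** Pigeonhole: three discs covering all [3 * n] points cannot each contain fewer than [n]. *)
Lemma admissible_third {R : rcfType} (n : nat) : admissible (3 * n) (2^-1 : R) n.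
Proof.
move=> P [_ Pd].
have [|z Hz] := jung [seq P i | i <- enum 'I_(3 * n)].
  by move=> _ _ /mapP[i _ ->] /mapP[j _ ->]; have := Pd i j; rewrite dist2_le // expr1n.
have [c Hc] := three_discs z.
apply: contrapT => nex.
have lt k : (covered P (c k) 2^-1 < n)%N.
  by rewrite ltnNge; apply/negP => h; apply: nex; exists (c k).
have : (\sum_(i < 3 * n) 1 <= \sum_k covered P (c k) 2^-1)%N.
  under eq_bigr do rewrite /covered -sum1_card (eq_bigl _ _ (in_set _)) big_mkcond /=.
  rewrite exchange_big /=; apply: leq_sum => i _.
  have [|k hk] := Hc (P i); first by apply: Hz; rewrite map_f ?mem_enum.
  by rewrite (bigD1 k) //= dist2_le ?invr_ge0 // half_sq hk.
rewrite sum_nat_const card_ord muln1 sum_ord3.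
have := lt 0; have := lt 1; have := lt (1 + 1); lia.
Qed.

Theorem theorem3 (R : realType) (n : nat) (hn : (0 < n)%N) :
  (n <= N (3 * n) (2^-1 : R) <= n.+1)%N.
Proof.
rewrite N_le andbT.
have h : (n < (3 * n).+1)%N by lia.
by apply: (leq_bigmax_cond (Ordinal h)); apply/asboolP/admissible_third.
Qed.
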